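(* There is an $\epsilon > 0$ such that any $\epsilon$-approximate streaming algorithm for Borda-CC or Borda-M needs $\Omega(m)$ space, where $m$ is the number of candidates.
   Context: An election $E=(C,V)$ consists of a set of candidates $C=\{c_1,\dots,c_m\}$ and a collection of voters $V=(v_1,\dots,v_n)$, each with a vote. In a Borda-based election the vote of each voter $v$ is a total order $\succ_v$ over $C$; $\mathrm{pos}_v(c)$ denotes the position of candidate $c$ in $v$'s order (the top-ranked candidate has position $1$). Let $k\le m$. A committee is a set $S\subseteq C$ of $k$ candidates. Satisfaction: $\beta(v,c)=m-\mathrm{pos}_v(c)$. A CC-assignment for a committee $S$ is a function $\Phi:V\to S$; an M-assignment is a CC-assignment such that $\lfloor n/k\rfloor\le|\Phi^{-1}(c)|\le\lceil n/k\rceil$ for each $c\in S$. The total satisfaction of $V$ from $S$ under $\Phi$ is $\sum_{v\in V}\beta(v,\Phi(v))$. The total satisfaction of $V$ from $S$ under the Chamberlin--Courant rule (respectively the Monroe rule) is the maximum of this quantity over all CC-assignments (respectively all M-assignments) $\Phi$. Borda-CC (respectively Borda-M) is the voting rule that, given $E$ and $k$, outputs all size-$k$ committees with the highest total satisfaction under the Chamberlin--Courant (respectively Monroe) rule (the winning committees). A size-$k$ committee is $\epsilon$-winning (for a given rule and an election with $n$ voters) if it is either a winning committee, or it can become a winning committee by changing at most $\epsilon n$ votes. Vote streams: the set of candidates $C$ is known, and the voters $v_1,\dots,v_n$ arrive (vote) one at a time, each exactly once, in arbitrary order; $n$ is the length of the stream. A streaming algorithm is a randomized algorithm that, given $k$,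 processes the stream in one pass and then outputs a size-$k$ committee; its space is measured in bits. It is an $\epsilon$-approximate streaming algorithm for a rule if it returns, with high probability, an $\epsilon$-winning committee for that rule. ''With high probability'' means with probability $1-O(1/n)$. *)

(* Defs.v *)
From HB Require Import structures.
From mathcomp Require Import all_boot all_order all_fingroup all_algebra.
From mathcomp Require Import reals.

Set Implicit Arguments.
Unset Strict Implicit.
Unset Printing Implicit Defensive.
Import Order.TTheory GRing.Theory Num.Theory.

Local Open Scope ring_scope.

(* The candidates are the elements of 'I_m.  A vote is a total order on them,
   encoded by the permutation that sends a candidate to the number of
   candidates ranked above it; positions are counted from 1. *)
Definition vote (m : nat) : Type := {perm 'I_m}.

Definition pos (m : nat) (v : vote m) (c : 'I_m) : nat := (v c).+1.

Definition beta (m : nat) (v : vote m) (c : 'I_m) : nat := (m - pos v c)%N.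

Variant borda_rule := BordaCC | BordaM.

Section Elections.
Variables (n m : nat).
Implicit Types (V : n.-tuple (vote m)) (S : {set 'I_m}).
Implicit Types (Phi : {ffun 'I_n -> 'I_m}) (k : nat) (rule : borda_rule).

Definition CC_assignment S Phi : bool := [forall i, Phi i \in S].

(* (n + k.-1) %/ k is the ceiling of n / k. *)
Definition M_assignment k S Phi : bool :=
  CC_assignment S Phi &&
  [forall c in S,
     (n %/ k <= #|[set i | Phi i == c]| <= (n + k.-1) %/ k)%N].

Definition assignment rule k S Phi : bool :=
  match rule with
  | BordaCC => CC_assignment S Phi
  | BordaM => M_assignment k S Phi
  end.

(* For 0 < k <= m and #|S| = k, some Phi satisfies the condition, so the
   default value 0 of \max over an empty range plays no role. *)
Definition satisfaction rule k V S : nat :=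
  (\max_(Phi : {ffun 'I_n -> 'I_m} | assignment rule k S Phi)
      \sum_(i < n) beta (tnth V i) (Phi i))%N.

Definition winning rule k V S : bool :=
  (#|S| == k) &&
  [forall T : {set 'I_m},
     (#|T| == k) ==> (satisfaction rule k V T <= satisfaction rule k V S)%N].

Definition changed_votes V V' : nat := #|[set i | tnth V i != tnth V' i]|.

Definition eps_winning (R : realType) (eps : R) rule k V S : bool :=
  (#|S| == k) &&
  (winning rule k V S ||
   [exists V' : n.-tuple (vote m),
      ((changed_votes V V')%:R <= eps * n%:R) && winning rule k V' S]).

End Elections.

(* Toss p h x y flips a coin of bias p and continues as x with probability p
   and as y with probability 1 - p; every finitely supported distribution
   arises in this way, and every leaf has positive probability. *)
Inductive rand (R : realType) (A : Type) : Type :=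
| Ret of A
| Toss (p : R) of 0 < p < 1 & rand R A & rand R A.

Arguments Ret {R A}.
Arguments Toss {R A}.

Fixpoint bind (R : realType) (A B : Type) (x : rand R A) (f : A -> rand R B) :
    rand R B :=
  match x with
  | Ret a => f a
  | Toss p h y z => Toss p h (bind y f) (bind z f)
  end.

Fixpoint prob (R : realType) (A : Type) (x : rand R A) (E : pred A) : R :=
  match x with
  | Ret a => (E a)%:R
  | Toss p _ y z => p * prob y E + (1 - p) * prob z E
  end.

Fixpoint outcomes (R : realType) (A : Type) (x : rand R A) : seq A :=
  match x with
  | Ret a => [:: a]
  | Toss _ _ y z => outcomes y ++ outcomes z
  end.

(* The memory kept between two votes is a bit string.  The model is
   nonuniform: no computability or time constraint is put on the fields.
   A single machine serves streams of every length. *)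
Record stream_alg (R : realType) (m : nat) := StreamAlg {
  init : rand R (seq bool);
  step : seq bool -> vote m -> rand R (seq bool);
  output : seq bool -> rand R {set 'I_m} }.

Definition memory_after (R : realType) (m : nat) (a : stream_alg R m)
    (w : seq (vote m)) : rand R (seq bool) :=
  foldl (fun x v => bind x (fun mu => step a mu v)) (init a) w.

Definition result (R : realType) (m : nat) (a : stream_alg R m)
    (w : seq (vote m)) : rand R {set 'I_m} :=
  bind (memory_after a w) (output a).

(* Largest number of bits ever stored, over all streams of length n, all
   moments of the pass and all coin outcomes. *)
Definition machine_space (R : realType) (m : nat) (a : stream_alg R m)
    (n : nat) : nat :=
  (\max_(V : n.-tuple (vote m)) \max_(i < n.+1)
     \max_(mu <- outcomes (memory_after a (take i V))) size mu)%N.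

(* An algorithm knows the candidates and is given the committee size k: it is
   a family of machines A m k, of which only those with 0 < k <= m matter. *)
Definition bits_used (R : realType) (A : forall m k : nat, stream_alg R m)
    (m n : nat) : nat :=
  (\max_(1 <= k < m.+1) machine_space (A m k) n)%N.

(* Success with probability 1 - O(1/n): the constants K and n1 may depend on
   the algorithm, but not on m, k or the stream. *)
Definition eps_approximate (R : realType) (rule : borda_rule) (eps : R)
    (A : forall m k : nat, stream_alg R m) : Prop :=
  exists (K : R) (n1 : nat), forall n m k : nat,
    (n1 <= n)%N -> (0 < k <= m)%N ->
    forall V : n.-tuple (vote m),
      1 - K / n%:R <= prob (result (A m k) V) (eps_winning eps rule k V).

(* Main.v *)
(* The committee size k = 1 suffices: both rules then elect a Borda winner, and
   a stream encodes an instance of INDEX.  The first half of the votes encodes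
   x in {0,1}^N: the candidates j and N + j occupy positions j and N + j,
   swapped when x_j = 1, so that one of them beats the other by N places per
   vote.  The second half puts i and N + i on top and the other candidates below
   2N behind all remaining ones, so that the only eps-winning committee reveals
   x_i.

   Hence some memory state reached after the first half determines x up to a
   small fraction of the coordinates, and the 2^(s+1) states of at most s bits
   yield a covering of the Hamming cube by balls of small radius.  Such a ball
   is exponentially smaller than the cube, so s is linear in N. *)
Require Import Defs.
From HB Require Import structures.
From mathcomp Require Import all_boot all_order all_fingroup all_algebra.
From mathcomp Require Import unstable reals zify ring lra.
Set Implicit Arguments.
Unset Strict Implicit.
Unset Printing Implicit Defensive.
Import Order.TTheory GRing.Theory Num.Theory.
Local Open Scope ring_scope.

(** * Finite probability: averaging over coin tosses, splitting a run *)

Section Rand.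
Variable R : realType.

Lemma bindA (A B C : Type) (x : rand R A) (f : A -> rand R B)
    (g : B -> rand R C) :
  bind (bind x f) g = bind x (fun a => bind (f a) g).
Proof. by elim: x => //= p h y -> z ->. Qed.

Lemma bind_Ret (A : Type) (x : rand R A) : bind x Ret = x.
Proof. by elim: x => //= p h y -> z ->. Qed.

Lemma prob_mono (A : Type) (x : rand R A) (E F : pred A) :
  subpred E F -> prob x E <= prob x F.
Proof.
move=> sEF; elim: x => [a|p /andP[p0 p1] y IHy z IHz] /=.
  by rewrite ler_nat; case: (boolP (E a)) => // /sEF ->.
by apply: lerD; apply: ler_wpM2l => //; lra.
Qed.

Lemma prob_ge0 (A : Type) (x : rand R A) (E : pred A) : 0 <= prob x E.
Proof.
elim: x => [a|p /andP[p0 p1] y IHy z IHz] /=; first exact: ler0n.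
by rewrite addr_ge0 // mulr_ge0 //; lra.
Qed.

Lemma prob_predC (A : Type) (x : rand R A) (E : pred A) :
  prob x (predC E) = 1 - prob x E.
Proof.
elim: x => [a|p h y IHy z IHz] /=; last by rewrite IHy IHz; ring.
by case: (E a); rewrite /= ?subr0 ?subrr.
Qed.

Lemma prob_cover_ge1 (A : Type) (x : rand R A) (E F : pred A) :
  (forall a, E a || F a) -> 1 <= prob x E + prob x F.
Proof.
move=> EF; have : prob x (predC E) <= prob x F.
  by apply: prob_mono => a /= nEa; have := EF a; rewrite (negbTE nEa).
by rewrite prob_predC; lra.
Qed.

(** By linearity the first sum is the mean, over the coins of [x], of the second one, and some
    outcome does no worse than the mean. Summing over [i] first yields a single memory state that
    serves all queries at once. *)
Lemma bind_sum_le (A : eqType) (B : Type) (I : finType) (x : rand R A)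
    (f : I -> A -> rand R B) (E : I -> pred B) (t : R) :
    \sum_i prob (bind x (f i)) (E i) <= t ->
  exists2 a, a \in outcomes x & \sum_i prob (f i a) (E i) <= t.
Proof.
elim: x => [a|p /andP[p0 p1] y IHy z IHz] /=; first by exists a; rewrite ?inE.
rewrite big_split /= -!mulr_sumr => le_t.
set sy := \sum_i _ in le_t; set sz := \sum_i _ in le_t.
have [/IHy[a ay le_a]|lt_y] := lerP sy t.
  by exists a; rewrite // mem_cat ay.
have [/IHz[a az le_a]|lt_z] := lerP sz t.
  by exists a; rewrite // mem_cat az orbT.
exfalso; have : 0 < p * (sy - t) by apply: mulr_gt0; rewrite ?subr_gt0.
have : 0 < (1 - p) * (sz - t) by apply: mulr_gt0; rewrite ?subr_gt0.
lra.
Qed.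

Lemma memory_after_cat (m : nat) (a : stream_alg R m) (w w' : seq (vote m)) :
  memory_after a (w ++ w') =
  bind (memory_after a w)
    (fun mu => foldl (fun x v => bind x (fun nu => step a nu v)) (Ret mu) w').
Proof.
rewrite /memory_after foldl_cat; set x := foldl _ (init a) w; move: x => x.
have foldl_bind y (f : seq bool -> rand R (seq bool)) :
    foldl (fun x v => bind x (fun nu => step a nu v)) (bind y f) w' =
    bind y (fun mu =>
      foldl (fun x v => bind x (fun nu => step a nu v)) (f mu) w').
  by elim: w' f => //= v w1 IH f; rewrite bindA IH.
by rewrite -foldl_bind bind_Ret.
Qed.

End Rand.

(** * Covering codes in the Hamming cube and memory size *)

Section Covering.
Local Open Scope nat_scope.

Lemma sum_hamming_weight (N : nat) (y : {ffun 'I_N -> bool}) :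
  \sum_(x : {ffun 'I_N -> bool}) \prod_i (if x i == y i then 2 else 1) = 3 ^ N.
Proof.
rewrite -(bigA_distr_bigA (fun i b => if b == y i then 2 else 1)) /=.
rewrite (eq_bigr (fun=> 3)) ?prod_nat_const ?card_ord // => i _.
by rewrite big_bool; case: (y i).
Qed.

(** Double counting with the weight 2 per coordinate where [x] agrees with a centre. The weights
    around one centre sum to [3 ^ N], while each of the [2 ^ N] points has weight at least
    [2 ^ N / 2 ^ t] around some centre. *)
Lemma hamming_covering (N t : nat) (T : finType)
    (Y : T -> {ffun 'I_N -> bool}) :
    (forall x : {ffun 'I_N -> bool},
       exists mu, #|[set i | x i != Y mu i]| <= t) ->
  4 ^ N <= #|T| * 2 ^ t * 3 ^ N.
Proof.
move=> covY; rewrite -[4]/(2 * 2) expnMn.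
have -> : 2 ^ N * 2 ^ N = \sum_(x : {ffun 'I_N -> bool}) 2 ^ N.
  by rewrite sum_nat_const card_ffun card_bool card_ord.
rewrite mulnAC -sum_nat_const big_distrl /=.
under [X in _ <= X]eq_bigr => mu _ do
  rewrite -(sum_hamming_weight (Y mu)) big_distrl /=.
rewrite exchange_big /=; apply: leq_sum => x _.
have [mu mu_t] := covY x.
rewrite (bigD1 mu) //=; apply: leq_trans (leq_addr _ _).
(* Each factor 2 goes to the weight on agreement and to a second product on disagreement; the latter
   is at most [2 ^ t]. *)
have -> : 2 ^ N = \prod_(i < N) ((if x i == Y mu i then 2 else 1)
                                 * (if x i != Y mu i then 2 else 1)).
  rewrite -[in LHS](card_ord N) -prod_nat_const.
  by apply: eq_bigr => i _; case: eqP.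
rewrite big_split /= leq_mul // -big_mkcond prod_nat_const.
by rewrite leq_exp2l // -cardsE.
Qed.

(* A string of at most s bits, padded to s + 1 bits by a prefix 0...01. *)
Lemma bounded_string_code (s : nat) (mu : seq bool) : size mu <= s ->
  exists c : s.+1.-tuple bool, drop (index true c).+1 c = mu.
Proof.
move=> le_s; pose c := nseq (s - size mu) false ++ true :: mu.
have size_c : size c == s.+1 by rewrite size_cat size_nseq /= addnS subnK.
exists (Tuple size_c) => /=; rewrite /c index_cat mem_nseq andbF /= size_nseq.
by rewrite addn0 drop_cat size_nseq ltnNge leqnSn subSnn /= drop0.
Qed.

Lemma covering_memory_bound (q s : nat)
    (Y : seq bool -> {ffun 'I_(5 * q) -> bool}) :
    (forall x : {ffun 'I_(5 * q) -> bool},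
       exists2 mu, size mu <= s & #|[set i | x i != Y mu i]| <= q) ->
  q <= s.+1.
Proof.
move=> covY; have [-> //|q_gt0] := posnP q.
pose Y' (c : s.+1.-tuple bool) := Y (drop (index true c).+1 c).
have /hamming_covering : forall x : {ffun 'I_(5 * q) -> bool},
    exists c, #|[set i | x i != Y' c i]| <= q.
  move=> x; have [mu mu_s mu_q] := covY x.
  by have [c def_mu] := bounded_string_code mu_s; exists c; rewrite /Y' def_mu.
rewrite card_tuple card_bool -expnD !expnM => le4.
(* Since 243 <= 256, the covering inequality becomes [10 * q <= s.+1 + q + 8 * q]. *)
have le3 : (3 ^ 5) ^ q <= 2 ^ (8 * q) by rewrite expnM leq_exp2r.
have : (4 ^ 5) ^ q <= 2 ^ (s.+1 + q + 8 * q).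
  by rewrite expnD (leq_trans le4) // leq_mul2l le3 orbT.
by rewrite -[4]/(2 ^ 2) -!expnM leq_exp2l //; lia.
Qed.

End Covering.

(** * Committees of size one: Borda winners and their stability *)

Section SingleWinner.
Local Open Scope nat_scope.
Variables (n m : nat).
Implicit Types (V : n.-tuple (vote m)) (c w : 'I_m).

Definition rank_sum (V : seq (vote m)) (c : 'I_m) : nat := \sum_(v <- V) v c.

(** For [k = 1] both Monroe bounds equal [n], which the constant assignment meets, so the two rules
    coincide. *)
Lemma assignment_set1 rule c (Phi : {ffun 'I_n -> 'I_m}) :
  assignment rule 1 [set c] Phi = (Phi == [ffun=> c]).
Proof.
have CC : CC_assignment [set c] Phi = (Phi == [ffun=> c]).
  apply/forallP/eqP => [Pc|-> i]; last by rewrite ffunE inE.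
  by apply/ffunP => i; rewrite ffunE; apply/set1P.
case: rule => //=; rewrite /M_assignment CC; case: eqP => // ->.
apply/forall_inP => d /set1P ->.
rewrite divn1 addn0 divn1 (_ : [set i | _] = setT) ?cardsT ?card_ord ?leqnn //.
by apply/setP => i; rewrite !inE ffunE eqxx.
Qed.

Lemma satisfaction_set1 rule V c :
  satisfaction rule 1 V [set c] + rank_sum V c = n * m.-1.
Proof.
rewrite /satisfaction (big_pred1 [ffun=> c]); last exact: assignment_set1.
rewrite /rank_sum big_tuple -big_split /= (eq_bigr (fun=> m.-1)).
  by rewrite sum_nat_const card_ord.
by move=> i _; rewrite ffunE /beta /pos; have := ltn_ord (tnth V i c); lia.
Qed.

Lemma rank_sum_changed V V' c :
  rank_sum V c <= rank_sum V' c + m * changed_votes V V'.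
Proof.
rewrite /rank_sum !big_tuple /changed_votes -sum1_card big_distrr /=.
rewrite [X in _ + X]big_mkcond -big_split /=; apply: leq_sum => i _.
rewrite inE muln1; case: eqP => [-> | _] /=; first exact: leq_addr.
by rewrite (leq_trans (ltnW (ltn_ord _))) // leq_addl.
Qed.

Lemma changed_votesC V V' : changed_votes V V' = changed_votes V' V.
Proof. by apply: eq_card => i; rewrite !inE eq_sym. Qed.

Lemma winning_set1 rule V c w :
  winning rule 1 V [set c] -> rank_sum V c <= rank_sum V w.
Proof.
case/andP=> _ /forallP /(_ [set w]); rewrite cards1 eqxx /= => le_sat.
by have := satisfaction_set1 rule V c; have := satisfaction_set1 rule V w; lia.
Qed.

(** In the changed election [c] is at least as good as [w]. Going there with [c] and back with [w]
    costs at most [m] per changed vote each time, hence the factor 2. *)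
Lemma eps_winning_rank_sum (R : realType) (eps : R) rule V S w :
    (0 <= eps)%R -> eps_winning eps rule 1 V S ->
  exists2 c, S = [set c] &
    exists2 d : nat, (d%:R <= eps * n%:R)%R &
      rank_sum V c <= rank_sum V w + 2 * (m * d).
Proof.
move=> eps0 /andP[/cards1P[c ->] win]; exists c => //.
have {win} [V' le_d win] : exists2 V',
    ((changed_votes V V')%:R <= eps * n%:R)%R & winning rule 1 V' [set c].
  case/orP: win => [win | /existsP[V' /andP[le_d win]]]; last by exists V'.
  exists V => //; rewrite (_ : changed_votes V V = 0) ?mulr_ge0 //.
  by apply/eqP; rewrite cards_eq0; apply/eqP/setP => i; rewrite !inE eqxx.
exists (changed_votes V V') => //.
have := rank_sum_changed V V' c; have := rank_sum_changed V' V w.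
by rewrite changed_votesC; have := winning_set1 w win; lia.
Qed.

End SingleWinner.

Lemma rank_sum_two_blocks (m a b : nat) (u v : vote m) (c : 'I_m) :
  rank_sum (nseq a u ++ nseq b v) c = (a * u c + b * v c)%N.
Proof. by rewrite /rank_sum big_cat /= !big_nseq !iter_addn_0 !(mulnC _ (_ c)).
Qed.

(** * Vote streams that encode INDEX *)

Section Index.
Local Open Scope nat_scope.
Variables (m N : nat).
Hypotheses (N_gt4 : 4 < N) (m_ge : 4 * N <= m).

Lemma cand_proof (i : 'I_N) (b : bool) : i + b * N < m.
Proof. by have := ltn_ord i; case: b; lia. Qed.

Definition cand (i : 'I_N) (b : bool) : 'I_m := Ordinal (cand_proof i b).

Lemma cand_inj i b j c : cand i b = cand j c -> i = j /\ b = c.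
Proof.
move/(congr1 val) => /= eq_c; have := ltn_ord i; have := ltn_ord j.
by move: eq_c; case: b; case: c => e li lj; split=> //;
  try apply: val_inj => /=; lia.
Qed.

Lemma candP (c : 'I_m) : c < 2 * N -> exists i b, c = cand i b.
Proof.
move=> lt_c; have [ltN|leN] := ltnP c N.
  by exists (Ordinal ltN), false; apply: val_inj; rewrite /= addn0.
have lt' : c - N < N by lia.
by exists (Ordinal lt'), true; apply: val_inj => /=; lia.
Qed.

Section EncodingVote.
Variable x : {ffun 'I_N -> bool}.

(** The xor puts [cand i (x i)] at place [i] and its partner at [N + i], and makes the map its own
    inverse. *)
Definition encoding_map (c : 'I_m) : 'I_m :=
  if [pick p : 'I_N * bool | c == cand p.1 p.2] is Some p
  then cand p.1 (p.2 (+) x p.1) else c.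

Lemma encoding_map_cand i b : encoding_map (cand i b) = cand i (b (+) x i).
Proof.
rewrite /encoding_map; case: pickP => [[j c] /eqP /= /cand_inj[<- <-] //|].
by move/(_ (i, b)); rewrite /= eqxx.
Qed.

Lemma encoding_map_dummy (c : 'I_m) : 2 * N <= c -> encoding_map c = c.
Proof.
move=> leNc; rewrite /encoding_map; case: pickP => // -[i b] /eqP /= eq_c.
by move: leNc; rewrite eq_c /=; have := ltn_ord i; case: b {eq_c}; lia.
Qed.

Lemma encoding_map_involutive : involutive encoding_map.
Proof.
move=> c; have [/candP[i [b ->]]|leNc] := ltnP c (2 * N).
  by rewrite !encoding_map_cand addbK.
by rewrite !encoding_map_dummy.
Qed.

Definition encoding_vote : vote m := perm (inv_inj encoding_map_involutive).

Lemma encoding_vote_cand i b : encoding_vote (cand i b) = cand i (b (+) x i).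
Proof. by rewrite permE encoding_map_cand. Qed.

Lemma encoding_vote_dummy (c : 'I_m) : 2 * N <= c -> encoding_vote c = c.
Proof. by rewrite permE; exact: encoding_map_dummy. Qed.

End EncodingVote.

Lemma place0_proof : 0 < m. Proof. lia. Qed.
Lemma place1_proof : 1 < m. Proof. lia. Qed.
Let place0 := Ordinal place0_proof.
Let place1 := Ordinal place1_proof.

(** Reversal sends all encoding candidates to the last [2 * N] places; the transpositions then lift
    the queried pair to the top two. *)
Definition query_vote (i : 'I_N) : vote m :=
  (perm (@rev_ord_inj m) * tperm (rev_ord (cand i false)) place0
   * tperm (rev_ord (cand i true)) place1)%g.

Lemma query_vote_other i j b : j != i -> m - 2 * N <= query_vote i (cand j b).
Proof.
move=> ji; rewrite !permM (permE (@rev_ord_inj m)).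
have ne c : rev_ord (cand i c) != rev_ord (cand j b).
  by rewrite (inj_eq rev_ord_inj); apply: contra ji => /eqP/cand_inj[->].
have lt_j : j + b * N < 2 * N by have := ltn_ord j; case: b {ne}; lia.
rewrite [tperm _ place0 _]tpermD ?ne //; last by rewrite -val_eqE /=; lia.
rewrite tpermD ?ne /=; [lia | by [] | by rewrite -val_eqE /=; lia].
Qed.

Lemma query_vote_queried i b : query_vote i (cand i b) <= 1.
Proof.
rewrite !permM (permE (@rev_ord_inj m)); have := ltn_ord i => lt_i.
case: b; last first.
  rewrite tpermL tpermD //; rewrite -val_eqE /=; lia.
rewrite [tperm _ place0 _]tpermD ?tpermL //; rewrite -val_eqE /=; lia.
Qed.

Definition index_stream n (x : {ffun 'I_N -> bool}) (i : 'I_N) : seq (vote m) :=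
  nseq n./2 (encoding_vote x) ++ nseq (n - n./2) (query_vote i).

Lemma size_index_stream n x i : size (index_stream n x i) == n.
Proof. by rewrite size_cat !size_nseq; lia. Qed.

Definition index_tuple n x i : n.-tuple (vote m) :=
  Tuple (size_index_stream n x i).

(** The partner and the dummies lose at least [N] places per encoding vote, the other pairs at least
    [2 * N] places of rank per query vote. The slack [n - n./2] pays for [cand i (x i)] being
    possibly second in the query votes. *)
Lemma index_stream_gap n (x : {ffun 'I_N -> bool}) i (c : 'I_m) :
    c != cand i (x i) ->
  rank_sum (index_stream n x i) (cand i (x i)) + n./2 * N
    <= rank_sum (index_stream n x i) c + (n - n./2).
Proof.
move=> ne_c; rewrite !rank_sum_two_blocks encoding_vote_cand addbb /= addn0.
have lt_i := ltn_ord i; have := query_vote_queried i (x i).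
set t := nat_of_ord (query_vote i _) => le_t.
set a := n./2; set b := n - a; have le_ab : a <= b by lia.
have le_bt : b * t <= b by rewrite -{2}[b]muln1 leq_mul2l le_t orbT.
have [/candP[j [d def_c]]|ge_c] := ltnP c (2 * N); last first.
  rewrite encoding_vote_dummy // -/a -/b.
  have le_c : a * (2 * N) <= a * c by rewrite leq_mul2l ge_c orbT.
  by nia.
rewrite {}def_c in ne_c *; rewrite encoding_vote_cand /=.
have [ji|ne_ji] := eqVneq j i.
  rewrite {}ji in ne_c *; have -> : d (+) x i = true.
    by case: d (x i) ne_c => -[]; rewrite ?eqxx.
  by rewrite mul1n mulnDr; lia.
have := query_vote_other d ne_ji; set r := nat_of_ord _ => le_r.
have le_ai : a * i + a * N <= a * (2 * N) by rewrite -mulnDr leq_mul2l; lia.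
have le_aN : a * (2 * N) <= b * (2 * N) by rewrite leq_mul2r le_ab orbT.
have le_br : b * (2 * N) <= b * r by rewrite leq_mul2l; lia.
lia.
Qed.

Lemma index_stream_eps_winning (R : realType) rule n
    (x : {ffun 'I_N -> bool}) i S :
    m <= 8 * N -> 1 < n ->
    eps_winning (100%:R^-1 : R)%R rule 1 (index_tuple n x i) S ->
  S = [set cand i (x i)].
Proof.
move=> m_le n_gt1 win.
have eps_ge0 : (0 <= (100%:R^-1 : R))%R by rewrite invr_ge0 ler0n.
have [c -> [d le_d le_c]] := eps_winning_rank_sum (cand i (x i)) eps_ge0 win.
have [-> //|ne_c] := eqVneq c (cand i (x i)).
have := @index_stream_gap n x i c ne_c.
have le_dn : 100 * d <= n.
  by rewrite -(ler_nat R) natrM mulrC -ler_pdivlMr ?ltr0n // mulrC.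
move: le_c => /=; set p := rank_sum _ _; set p' := rank_sum _ _.
set a := n./2 => le_c gap; exfalso.
(* The changes gain at most [2 * m * d <= 0.48 * a * N], and the slack is
   [n - a <= 2 * a < a * N / 2]; together they stay below the gap [a * N]. *)
have le_na : n <= 3 * a by lia.
have le_md : m * (100 * d) <= (8 * N) * (3 * a) by apply: leq_mul => //; lia.
have lt_aN : 4 * a < a * N by rewrite mulnC ltn_pmul2l //; lia.
by lia.
Qed.

End Index.

(** * From a streaming algorithm to a covering of the cube *)

Section SpaceBound.
Variable R : realType.

Lemma outcome_le_machine_space (m n j : nat) (a : stream_alg R m)
    (V : n.-tuple (vote m)) (mu : seq bool) :
    (j <= n)%N -> mu \in outcomes (memory_after a (take j V)) ->
  (size mu <= machine_space a n)%N.
Proof.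
move=> le_jn mu_in; rewrite /machine_space.
apply: (bigop.bigmax_sup V) => //.
apply: (bigop.bigmax_sup (Ordinal (le_jn : j < n.+1)%N)) => //.
exact: leq_bigmax_seq mu_in _.
Qed.

Lemma machine_space_ge (rule : borda_rule) (m n q : nat) (a : stream_alg R m) :
    (0 < q)%N -> (20 * q <= m <= 40 * q)%N -> (1 < n)%N ->
    (forall V : n.-tuple (vote m),
       1 - 10%:R^-1 <=
         prob (result a V) (eps_winning (100%:R^-1 : R) rule 1 V)) ->
  (q <= (machine_space a n).+1)%N.
Proof.
move=> q_gt0 /andP[m_ge m_le] n_gt1 good; set N := (5 * q)%N.
have N_gt4 : (4 < N)%N by lia.
have m_geN : (4 * N <= m)%N by lia.
have m_leN : (m <= 8 * N)%N by lia.
pose cd (i : 'I_N) b := cand N_gt4 m_geN i b.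
pose answer (i : 'I_N) (mu : seq bool) : rand R {set 'I_m} :=
  bind (foldl (fun x v => bind x (fun nu => step a nu v)) (Ret mu)
          (nseq (n - n./2) (query_vote N_gt4 m_geN i))) (output a).
pose err mu i b : R := prob (answer i mu) (fun S => S != [set cd i b]).
(* A state decodes to the bits whose answer [cand i true] errs with probability below one half. *)
apply: (@covering_memory_bound q _
         (fun mu => [ffun i => err mu i true < 2^-1])).
move=> x; pose w := nseq n./2 (encoding_vote N_gt4 m_geN x).
have [|mu mu_in le_err] := @bind_sum_le R _ _ 'I_N (memory_after a w) answer
    (fun i S => S != [set cd i (x i)]) (N%:R * 10%:R^-1).
  rewrite mulr_natl -[in leRHS](card_ord N) -sumr_const; apply: ler_sum => i _.
  have := good (index_tuple N_gt4 m_geN n x i).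
  rewrite /result /index_tuple /= /index_stream memory_after_cat bindA.
  move=> good_i.
  rewrite -/w -/(answer i) in good_i *; set y := bind _ _ in good_i *.
  rewrite (_ : prob y _ = 1 - prob y (pred1 [set cd i (x i)])).
    apply: (@le_trans _ _ (1 - prob y (eps_winning (100%:R^-1 : R) rule 1
              (index_tuple N_gt4 m_geN n x i)))); last by lra.
    rewrite lerD2l lerN2; apply: prob_mono => S win /=.
    by rewrite (index_stream_eps_winning m_leN n_gt1 win) eqxx.
  by rewrite -prob_predC.
exists mu.
  (* The first half is common to all queries, so completing it with query 0 is enough to bound the
     state. *)
  apply: (@outcome_le_machine_space _ _ n./2 a (index_tuple N_gt4 m_geN n x
           (Ordinal (ltnW (ltnW (ltnW (ltnW N_gt4))))))); first by lia.
  by rewrite /= /index_stream take_cat size_nseq ltnn subnn take0 cats0.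
(* The two answers exclude each other, so their errors sum to at least 1 and each wrongly decoded
   bit has error at least 1/2. A total error of [N / 10] thus allows at most [N / 5 = q] wrong
   bits. *)
have : (#|[set i | x i != [ffun i => err mu i true < 2^-1] i]|)%:R * 2^-1
    <= \sum_i err mu i (x i).
  rewrite mulr_natl -sumr_const big_mkcond /=; apply: ler_sum => i _.
  rewrite inE ffunE; have err_ge0 b : 0 <= err mu i b.
    by apply: prob_ge0.
  have : 1 <= err mu i true + err mu i false.
    apply: prob_cover_ge1 => S; have [->|//] := eqVneq S [set cd i true].
    rewrite (inj_eq set1_inj); apply/eqP => /cand_inj[] //; exact: leN.
  by case: (x i); have [] := ltrP (err mu i true) 2^-1 => //=; lra.
rewrite -(ler_nat R) => le_d.
move: (le_trans le_d le_err); rewrite /N natrM; lra.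
Qed.

End SpaceBound.

Theorem theorem6 (R : realType) :
  exists eps : R, 0 < eps /\
  exists (c : R) (m0 : nat), 0 < c /\
  forall (rule : borda_rule) (A : forall m k : nat, stream_alg R m),
    eps_approximate rule eps A ->
    exists n0 : nat, forall m n : nat, (m0 <= m)%N -> (n0 <= n)%N ->
      c * m%:R <= (bits_used A m n)%:R.
Proof.
exists 100%:R^-1; split; first by rewrite invr_gt0 ltr0n.
(* For [m >= 40], the bound [m %/ 20 - 1] exceeds [m / 100] despite the floor and the lost bit. *)
exists 100%:R^-1, 40%N; split; first by rewrite invr_gt0 ltr0n.
move=> rule A [K [n1 A_good]].
(* The last summand makes the failure probability [K / n] at most 1/10, uniformly in [m]. *)
exists (n1 + 2 + Num.bound (10%:R * K))%N => m n m_ge40 n_ge.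
have le_K : K / n%:R <= 10%:R^-1.
  have n_gt0 : (0 : R) < n%:R by rewrite ltr0n; lia.
  rewrite ler_pdivrMr //; have : 10%:R * K <= n%:R.
    apply: le_trans (ltW (ltr_bound _)) _; rewrite ler_nat.
    exact: leq_trans (leq_addl _ _) n_ge.
  lra.
have := @machine_space_ge R rule m n (m %/ 20) (A m 1%N).
have le_bits : (machine_space (A m 1%N) n <= bits_used A m n)%N.
  rewrite /bits_used.
  apply: (@leq_bigmax_seq _ _ xpredT
            (fun k => machine_space (A m k) n) 1%N) => //.
  by rewrite mem_index_iota; lia.
move=> space_ge.
have {space_ge} : (m %/ 20 <= (machine_space (A m 1%N) n).+1)%N.
  apply: space_ge; [lia | lia | lia | move=> V].
  by apply: le_trans (A_good n m 1%N _ _ V); [lra | lia | lia].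
move=> le_q; rewrite mulrC ler_pdivrMr ?ltr0n // -natrM ler_nat; lia.
Qed.
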